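(* Let $n\ge 2$ and let $\mathcal{D}_n$ be the arrangement in $\mathbb{R}^n$ with hyperplanes $$x_i+x_j=-2,-1,0,\qquad x_i-x_j=-1,0,1\qquad (1\le i<j\le n).$$ Then the number of bounded regions of $\mathcal{D}_n$ is $$2^{n-1}\cdot\frac{(2n-3)!}{(n-2)!}\cdot(3n-4).$$
   Context: A region of an arrangement in $\mathbb{R}^n$ is a connected component of the complement of the union of its hyperplanes. A region is bounded if its intersection with the subspace spanned by the normal vectors to the hyperplanes is bounded. $\mathcal{D}_n$ is the translate (by $X_i=x_i+\tfrac12$) of the type $D$ Catalan arrangement $X_i\pm X_j=-1,0,1$. *)

(* Defs.v *)
From HB Require Import structures.
From mathcomp Require Import all_boot all_order all_algebra.
From mathcomp Require Import all_classical all_reals all_analysis.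

Set Implicit Arguments.
Unset Strict Implicit.
Unset Printing Implicit Defensive.

Import Order.TTheory GRing.Theory Num.Theory.
Import numFieldNormedType.Exports.
Local Open Scope classical_set_scope.
Local Open Scope ring_scope.

Definition dot (R : realType) (n : nat) (a x : 'rV[R]_n) : R :=
  \sum_(k < n) a 0 k * x 0 k.

(* A hyperplane is encoded by a pair (a, c) of a normal vector and an offset;
   it is the set of the x such that a . x = c. *)
Definition hyperplane (R : realType) (n : nat) (h : 'rV[R]_n * R) :
    set 'rV[R]_n :=
  [set x | dot h.1 x = h.2].

Definition arrangement (R : realType) (n : nat) := seq ('rV[R]_n * R).

Definition arr_complement (R : realType) (n : nat) (A : arrangement R n) :
    set 'rV[R]_n :=
  ~` (\bigcup_(h in [set` A]) hyperplane h).

Definition is_region (R : realType) (n : nat) (A : arrangement R n)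
    (C : set 'rV[R]_n) : Prop :=
  exists2 x, arr_complement A x & C = connected_component (arr_complement A) x.

Definition normal_span (R : realType) (n : nat) (A : arrangement R n) :
    {vspace 'rV[R]_n} :=
  <<[seq h.1 | h <- A]>>%VS.

Definition is_bounded_region (R : realType) (n : nat) (A : arrangement R n)
    (C : set 'rV[R]_n) : Prop :=
  is_region A C /\ bounded_set (C `&` [set x | x \in normal_span A]).

Definition basis_vec (R : realType) (n : nat) (i : 'I_n) : 'rV[R]_n :=
  delta_mx 0 i.

Definition arrangement_D (R : realType) (n : nat) : arrangement R n :=
  flatten
    [seq [seq (basis_vec R i + basis_vec R j, c) | c <- [:: -2; -1; 0]]
           ++ [seq (basis_vec R i - basis_vec R j, c) | c <- [:: -1; 0; 1]]
       | i <- enum 'I_n, j <- [seq k : 'I_n <- enum 'I_n | (i < k)%N]].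

(* Main.v *)
(* In the coordinates X = x + 1/2 the arrangement is invariant under signed
   permutations. Sort the absolute values of the X_i into Z_0 < Z_1 < ... <
   Z_(n-1) and let b_k be the number of the 2k points 1 - Z_j, 1 + Z_j (j < k)
   that lie below Z_k. The permutation, the signs and the code b determine the
   region, except that the sign of the smallest coordinate is irrelevant exactly
   when b_k <> k for all k > 0. A region is bounded iff every simple root is
   smaller than 1 on the points Z, and the codes that occur are then those with
   b_0 = b_1 = 0, b_k < 2k, and b_(k+1) > b_k or b_k = 0; each of them is
   realised by placing Z_0, Z_1, ... successively. Codes are counted by a
   reflection principle: with n = k + 2 there are C(2k+2, k) of them, and for
   C(2k+1, k) of them the last sign is irrelevant. This gives
   n! 2^(n-1) (2 C(2k+2, k) - C(2k+1, k)) bounded regions. *)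
Require Import Defs.
From mathcomp Require Import all_boot all_order all_fingroup all_algebra.
From mathcomp Require Import all_classical all_reals all_analysis.
From mathcomp Require Import zify ring lra.
Import numFieldNormedType.Exports.
Local Open Scope classical_set_scope.
Local Open Scope card_scope.

(** * Counting the codes of bounded regions *)

Section Counting.
Local Open Scope nat_scope.
Set Implicit Arguments.
Unset Strict Implicit.
Unset Printing Implicit Defensive.

Definition binsum p j := \sum_(i < j) 'C(p, i).

Lemma binsum0 p : binsum p 0 = 0.
Proof. by rewrite /binsum big_ord0. Qed.

Lemma binsumS p j : binsum p j.+1 = binsum p j + 'C(p, j).
Proof. by rewrite /binsum big_ord_recr. Qed.

Lemma binsum_pascal p j : binsum p.+1 j.+1 = binsum p j.+1 + binsum p j.
Proof.
elim: j => [|j IHj]; first by rewrite !binsumS !binsum0 !bin0.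
by rewrite binsumS IHj (binsumS p j.+1) (binsumS p j) binS; lia.
Qed.

(** These codes have length [k.+2], the first two entries being 0. The range [iota 0 (maxn a 1)]
    merges the two options for the previous entry: to be 0 or to be smaller than [a]. *)
Fixpoint code_last k a : seq (seq nat) :=
  if k is k'.+1 then
    if a < k.*2.+2 then
      [seq rcons l a | b <- iota 0 (maxn a 1), l <- code_last k' b]
    else [::]
  else if a == 0 then [:: [:: 0; 0]] else [::].

Definition code_valid (n : nat) (b : nat -> nat) :=
  b 0 = 0 /\ forall k, k.+1 < n ->
    [/\ k = 0 -> b k.+1 = 0, b k.+1 < k.+1.*2 & (b k == 0) || (b k < b k.+1)].

(** The entry [b k = k] puts Z_k between 1 - Z_0 and 1 + Z_0, the two middle ones of the 2k points;
    a split code never does so. *)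
Definition code_split (n : nat) (b : nat -> nat) :=
  forall k, k.+1 < n -> b k.+1 <> k.+1.

Lemma code_validS n b : code_valid n.+2 b <-> code_valid n.+1 b /\
  [/\ n = 0 -> b n.+1 = 0, b n.+1 < n.+1.*2 & (b n == 0) || (b n < b n.+1)].
Proof.
split=> [[b0 bS]|[[b0 bS] bn]].
  by split; [split=> // k kn; apply: bS; lia | apply: bS].
split=> // k; rewrite ltnS leq_eqVlt => /orP[/eqP[->] //|kn].
by apply: bS; lia.
Qed.

Lemma code_valid_eq n b b' : {in gtn n, b =1 b'} -> 0 < n ->
  code_valid n b -> code_valid n b'.
Proof.
move=> bb' n0 [b0 bS]; split; first by rewrite -bb'.
by move=> k kn; rewrite -(bb' k) -?(bb' k.+1) ?inE//; [exact: bS | exact: ltnW].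
Qed.

Lemma mem_code_last k a l : l \in code_last k a <->
  [/\ size l = k.+2, nth 0 l k.+1 = a & code_valid k.+2 (nth 0 l)].
Proof.
elim: k a l => [|k IHk] a l.
  rewrite /=; split.
    case: eqP => [->|_] //.
    by rewrite mem_seq1 => /eqP->; split=> //; split=> // -[|k].
  case: l => [|x [|y [|? ?]]] [] //= _ <- [/= ->] /(_ 0 isT)[/(_ erefl) /= ->].
  by rewrite mem_seq1.
rewrite /=; split.
  case: ifP => [ak|_]; last by [].
  case/allpairsPdep => b [l' [+ /IHk[sl' bE vl'] ->]].
  rewrite mem_iota /= add0n => bm.
  split; [by rewrite size_rcons sl' | by rewrite nth_rcons sl' ltnn eqxx |].
  apply/code_validS; split.
    apply: code_valid_eq vl' => // i; rewrite inE => ik.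
    by rewrite nth_rcons sl' ik.
  rewrite !nth_rcons sl' ltnn eqxx ltnSn bE; split=> //; lia.
case=> sl la /code_validS[vl [_ al lab]]; rewrite -la.
have -> : nth 0 l k.+2 < k.+1.*2.+2 by lia.
move: sl vl lab; case/lastP: l la al => [//|l x] + + [].
rewrite size_rcons nth_rcons => la al [sl].
rewrite nth_rcons sl ltnn eqxx ltnSn => vl lab.
apply/allpairsPdep; exists (nth 0 l k.+1), l; split => //.
  by rewrite mem_iota; lia.
apply/IHk; split=> //; apply: code_valid_eq vl => // i; rewrite inE => ik.
by rewrite nth_rcons sl ik.
Qed.

Lemma uniq_code_last k a : uniq (code_last k a).
Proof.
elim: k a => [|k IHk] a /=; first by case: eqP.
case: ifP => // _; apply: allpairs_uniq_dep => [|b _|]; first exact: iota_uniq.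
  exact: IHk.
move=> u v /allpairsPdep[b [l [_ /mem_code_last[_ lb _] ->]]].
case/allpairsPdep=> b' [l' [_ /mem_code_last[_ lb' _] ->]] /=.
by move/rcons_inj => [ll']; rewrite -lb -lb' ll'.
Qed.

Lemma size_code_lastS k a : size (code_last k.+1 a) =
  if a < k.*2.+4 then \sum_(b < maxn a 1) size (code_last k b) else 0.
Proof.
rewrite /= doubleS; case: ifP => // _.
rewrite size_allpairs_dep sumnE big_map.
by rewrite -(big_mkord xpredT (fun b => size (code_last k b))) /index_iota subn0.
Qed.

(** Both partial sums obey the summed Pascal rule, so adding the count for [a.+1] passes from row
    [a] to row [a.+1]. The left [binsum] is the reflected term; truncated subtraction makes it
    vanish while [a <= k.+2]. *)
Lemma sum_size_code_last k : size (code_last k 0) = 1 ->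
  (forall a, a < k.*2.+2 ->
     size (code_last k a.+1) + binsum a (a - k.+1) = binsum a k) ->
  forall a, a < k.*2.+3 ->
  \sum_(b < a.+1) size (code_last k b) + binsum a (a - k.+2) = binsum a k.+1.
Proof.
move=> N0 NS; elim=> [|a IHa] ak.
  by rewrite big_ord1 N0 sub0n binsum0 /binsum big_ord_recl bin0 big1.
rewrite big_ord_recr /=; have := IHa (ltnW ak); have := NS a ak.
rewrite binsum_pascal.
have [ka|ka] := leqP k.+2 a.
  rewrite (_ : a.+1 - k.+2 = (a - k.+2).+1) ?binsum_pascal; last lia.
  rewrite (_ : a - k.+1 = (a - k.+2).+1); last lia.
  by move=> <- <-; rewrite [X in _ + X = _]addnC addnACA.
have [-> -> ->] : [/\ a - k.+2 = 0, a.+1 - k.+2 = 0 & a - k.+1 = 0].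
  by split; lia.
by rewrite !binsum0 !addn0 => -> ->.
Qed.

(* Reflection principle: the subtracted term is 0 for small [a] and
   cancels the right-hand side at the forbidden value [a.+1 = k.*2.+2]. *)
Lemma size_code_last k : size (code_last k 0) = 1 /\
  forall a, a < k.*2.+2 ->
  size (code_last k a.+1) + binsum a (a - k.+1) = binsum a k.
Proof.
elim: k => [|k [N0 NS]].
  by split=> // -[|[|a]] //= _; rewrite subn1 !binsum0.
split; first by rewrite size_code_lastS /= big_ord1.
move=> a ak; rewrite size_code_lastS (maxn_idPl _)//.
case: ifPn => aS; first by apply: sum_size_code_last => //; lia.
have -> : a = k.*2.+3 by lia.
by congr binsum; lia.
Qed.

Definition codes k := flatten [seq code_last k a | a <- iota 0 k.*2.+2].

Lemma count_flatten_iota (f : nat -> seq (seq nat)) (p : pred (seq nat)) n :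
  count p (flatten [seq f a | a <- iota 0 n]) = \sum_(a < n) count p (f a).
Proof.
rewrite count_flatten -map_comp sumnE big_map.
by rewrite -(big_mkord xpredT (fun a => count p (f a))) /index_iota subn0.
Qed.

Lemma size_codes k : size (codes k) = 'C(k.*2.+2, k).
Proof.
rewrite -count_predT count_flatten_iota.
under eq_bigr do rewrite count_predT.
have [N0 NS] := size_code_last k.
(* This is the case [a = k.*2.+1], the largest last entry. The two partial sums of that row differ
   by its terms at [k.-1] and [k], which Pascal's rule merges; for [k = 0] only one term remains. *)
have := sum_size_code_last N0 NS (leqnSn k.*2.+2).
move: (\sum_(i < _) _) => S {N0 NS}.
case: k => [|k].
  by rewrite -[0.*2.+1 - 2]/0 !binsumS !binsum0 !bin0 addn0.
rewrite (_ : k.+1.*2.+1 - k.+3 = k); last lia.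
rewrite !binsumS => SE; rewrite binS; move: SE.
by rewrite -addnA addnC => /addnI ->; exact: addnC.
Qed.

(** * Codes for which the sign of the smallest coordinate is irrelevant *)

Definition splitb (l : seq nat) :=
  all (fun k => nth 0 l k.+1 != k.+1) (iota 0 (size l).-1).

Lemma splitbP l : reflect (code_split (size l) (nth 0 l)) (splitb l).
Proof.
apply: (iffP allP) => H k kl.
  by apply/eqP/H; rewrite mem_iota; lia.
by apply/eqP/H; move: kl; rewrite mem_iota; lia.
Qed.

Lemma splitb_rcons l a : splitb (rcons l a) =
  splitb l && ((size l == 0) || (a != size l)).
Proof.
case: l => [|x l] //; rewrite /splitb size_rcons.
rewrite -[(size (x :: l)).+1.-1]/((size l).+1) -addn1 iotaD all_cat add0n.
rewrite [all _ (iota (size l) 1)]/= andbT nth_rcons ltnn eqxx /=; congr (_ && _).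
apply: eq_in_all => k; rewrite mem_iota => kl.
by rewrite nth_rcons ifT//; lia.
Qed.

Lemma count_splitS k a : count splitb (code_last k.+1 a) =
  if (a < k.*2.+4) && (a != k.+2) then
    \sum_(b < maxn a 1) count splitb (code_last k b) else 0.
Proof.
rewrite /= doubleS; case: ifP => //= _.
rewrite (eq_map (g := fun b => [seq rcons l a | l <- code_last k b]))//.
rewrite count_flatten_iota.
case: ifPn => ak; last first.
  rewrite big1// => b _; rewrite count_map; apply/eqP; rewrite -leqn0 leqNgt.
  rewrite -has_count; apply/hasPn => l /mem_code_last[sl _ _] /=.
  by rewrite splitb_rcons sl /= (negbTE ak) andbF.
apply: eq_bigr => b _; rewrite count_map; apply: eq_in_count.
by move=> l /mem_code_last[sl _ _] /=; rewrite splitb_rcons sl ak andbT.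
Qed.

(** The forbidden last entry [k.+1] contributes 0, so the partial sums stand still there and
    afterwards lag one row behind: the sum up to [k.+1 + c] belongs to row [k + c]. The reflected
    term enters only in this second regime. *)
Lemma sum_count_split k : count splitb (code_last k 0) = 1 ->
    (forall a, a < k -> count splitb (code_last k a.+1) = binsum a k) ->
    count splitb (code_last k k.+1) = 0 ->
    (forall c, c <= k ->
       count splitb (code_last k (k.+2 + c)) + binsum (k + c) c
         = binsum (k + c) k) ->
  (forall a, a <= k ->
     \sum_(b < a.+1) count splitb (code_last k b) = binsum a k.+1) /\
  (forall c, c <= k.+1 ->
     \sum_(b < (k.+1 + c).+1) count splitb (code_last k b)
       + binsum (k + c) c.-1 = binsum (k + c) k.+1).
Proof.
move=> N0 Nlo Nmid Nhi.
have lo a : a <= k ->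
    \sum_(b < a.+1) count splitb (code_last k b) = binsum a k.+1.
  elim: a => [|a IHa] ak.
    by rewrite big_ord1 N0 /binsum big_ord_recl bin0 big1.
  by rewrite big_ord_recr /= IHa ?Nlo ?binsum_pascal// ltnW.
split=> //; elim=> [|c IHc] ck.
  by rewrite !addn0 /= binsum0 addn0 big_ord_recr /= Nmid lo// addn0.
rewrite addnS big_ord_recr /=; have := IHc (ltnW ck); have := Nhi c ck.
rewrite !addnS !addSn binsum_pascal.
case: c {IHc ck} => [|c] /=; first by rewrite !binsum0; lia.
by rewrite binsum_pascal; lia.
Qed.

Lemma count_split k : [/\ count splitb (code_last k 0) = 1,
    forall a, a < k -> count splitb (code_last k a.+1) = binsum a k,
    count splitb (code_last k k.+1) = 0 &
    forall c, c <= k ->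
    count splitb (code_last k (k.+2 + c)) + binsum (k + c) c = binsum (k + c) k].
Proof.
elim: k => [|k [N0 Nlo Nmid Nhi]].
  by split=> // c; rewrite leqn0 => /eqP->.
have [lo hi] := sum_count_split N0 Nlo Nmid Nhi.
split.
- by rewrite count_splitS /= big_ord1 N0.
- move=> a ak; rewrite count_splitS ifT; last lia.
  by rewrite (maxn_idPl _)// lo.
- by rewrite count_splitS eqxx andbF.
- move=> c ck; rewrite count_splitS; case: ifPn => ckS.
    rewrite (maxn_idPl _)//; have /= := hi c.+1.
    by rewrite !addSn !addnS; apply; lia.
  (* The last entry is now [k.+1.*2.+2], too large for a code: the count is 0 and the reflected term
     equals the right-hand side. *)
  by have -> : c = k.+1 by lia.
Qed.

Lemma count_split_codes k : count splitb (codes k) = 'C(k.*2.+1, k).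
Proof.
rewrite count_flatten_iota; have [N0 Nlo Nmid Nhi] := count_split k.
have := (sum_count_split N0 Nlo Nmid Nhi).2 k (leqnSn _).
rewrite addSn addnn; move: (\sum_(i < _) _) => S {N0 Nlo Nmid Nhi}.
case: k => [|k]; first by rewrite !binsumS !binsum0 !bin0 addn0.
rewrite !binsumS => SE; rewrite binS; move: SE.
by rewrite -addnA addnC => /addnI ->; exact: addnC.
Qed.

(* A code together with the sign that the smallest coordinate carries; it is
   normalised to [false] when both signs give the same region. *)
Definition signed_codes k : seq (seq nat * bool) :=
  [seq (l, false) | l <- codes k] ++
  [seq (l, true) | l <- codes k & ~~ splitb l].

Lemma size_signed_codes k :
  size (signed_codes k) + 'C(k.*2.+1, k) = 2 * 'C(k.*2.+2, k).
Proof.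
rewrite size_cat !size_map size_filter -count_split_codes -size_codes.
have <- := count_predC splitb (codes k).
have -> : count (fun l => ~~ splitb l) (codes k) = count (predC splitb) (codes k) by [].
by move: (count splitb _) (count (predC _) _) => x y; lia.
Qed.

Lemma uniq_codes k : uniq (codes k).
Proof.
rewrite /codes -(eq_map (f := fun a => [seq id l | l <- code_last k a])); last first.
  by move=> a; rewrite map_id.
apply: (@allpairs_uniq_dep _ _ _ (fun a l => l)) => [|a _|]; first exact: iota_uniq.
  exact: uniq_code_last.
move=> u v /allpairsPdep[a [l [_ /mem_code_last[_ la _] ->]]].
case/allpairsPdep=> a' [l' [_ /mem_code_last[_ la' _] ->]] /= ll'.
by rewrite -la -la' ll'.
Qed.

Lemma mem_codes k l : l \in codes k <->
  size l = k.+2 /\ code_valid k.+2 (nth 0 l).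
Proof.
split=> [/flatten_mapP[a _ /mem_code_last[]] // | [sl vl]].
apply/flatten_mapP; exists (nth 0 l k.+1); last exact/mem_code_last.
by case: vl => _ /(_ k (ltnSn _))[_ ? _]; rewrite mem_iota; lia.
Qed.

Lemma uniq_signed_codes k : uniq (signed_codes k).
Proof.
have inj (s : bool) : injective (fun l : seq nat => (l, s)) by move=> l l' [].
rewrite cat_uniq !(map_inj_uniq (inj _)) filter_uniq ?uniq_codes// andbT /=.
by apply/hasPn => _ /mapP[l _ ->]; apply/negP => /mapP[].
Qed.

Lemma mem_signed_codes k l s : (l, s) \in signed_codes k <->
  [/\ size l = k.+2, code_valid k.+2 (nth 0 l) &
      s -> ~ code_split k.+2 (nth 0 l)].
Proof.
rewrite mem_cat; split=> [/orP[]/mapP[l']|[sl vl sv]].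
- by move=> /mem_codes[? ?] [-> ->].
- rewrite mem_filter => /andP[/splitbP + /mem_codes[sl vl]] [-> _].
  by rewrite sl.
have lc : l \in codes k by apply/mem_codes.
case: s sv => sv; apply/orP; [right|left]; apply/mapP; exists l => //.
by rewrite mem_filter lc andbT; apply/splitbP; rewrite sl; apply: sv.
Qed.

(** With x = C(2k+1, k), the identity (k+2) C(2k+2, k) = (2k+2) x turns (k+2) (2 C(2k+2, k) - x)
    into (3k+2) x, and the quotient of factorials is x (k+1)!. *)
Lemma bounded_region_count k :
  k.+2`! * 2 ^ k.+1 * size (signed_codes k) =
  2 ^ k.+1 * (k.*2.+1`! %/ k`!) * (3 * k + 2).
Proof.
have Hs := size_signed_codes k.
have b1 := bin_fact (_ : k <= k.*2.+1); have b2 := bin_fact (_ : k <= k.*2.+2).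
move: b1 b2 => /(_ ltac:(lia)) b1 /(_ ltac:(lia)) b2.
rewrite (_ : k.*2.+1 - k = k.+1) in b1; last lia.
rewrite (_ : k.*2.+2 - k = k.+2) in b2; last lia.
have -> : k.*2.+1`! %/ k`! = 'C(k.*2.+1, k) * k.+1`!.
  by rewrite -b1 mulnCA mulKn ?fact_gt0.
have E : 'C(k.*2.+2, k) * k.+2 = k.*2.+2 * 'C(k.*2.+1, k).
  apply/eqP; rewrite -(eqn_pmul2r (fact_gt0 k)) -(eqn_pmul2r (fact_gt0 k.+1)).
  move: b2; rewrite factS (factS k.*2.+1) -b1 => b2; apply/eqP.
  by move: b2; set x := 'C(_, _); set y := 'C(_, _); nia.
rewrite factS; move: Hs E; set x := 'C(_, _); set y := 'C(_, _).
move: (size _) (k.+1`!) (2 ^ _) => z f g Hs E.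
have -> : k.+2 * f * g * z = g * f * (k.+2 * z) by lia.
have -> : g * (x * f) * (3 * k + 2) = g * f * (x * (3 * k + 2)) by lia.
by congr (_ * _); nia.
Qed.
End Counting.

(** * Points that realise a code *)

Section Realisation.
Set Implicit Arguments.
Unset Strict Implicit.
Unset Printing Implicit Defensive.
Import Order.TTheory GRing.Theory Num.Theory.
Local Open Scope ring_scope.
Variable R : realFieldType.
Implicit Types (Y Z : nat -> R) (b : nat -> nat) (n : nat).

Lemma exists_between (L U : seq R) :
  (forall l u, l \in L -> u \in U -> l < u) ->
  exists z, (forall l, l \in L -> l < z) /\ (forall u, u \in U -> z < u).
Proof.
move=> LU; elim: L LU => [|l L IHL] LU.
  elim: U {LU} => [|u U [z [_ zU]]]; first by exists 0; split.
  exists (Num.min z (u - 1)); split=> // v; rewrite inE => /orP[/eqP->|/zU zv].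
    by rewrite gt_min; apply/orP; right; lra.
  by rewrite gt_min zv.
have [z [Lz zU]] := IHL (fun l' u Ll' => LU l' u (mem_behead (s := l :: L) Ll')).
have [lz|zl] := ltP l z.
  exists z; split=> // l'; rewrite inE => /orP[/eqP->//|]; exact: Lz.
have lU u : u \in U -> l < u by apply: LU; rewrite mem_head.
have [w [lw wU]] : exists w, l < w /\ forall u, u \in U -> w < u.
  elim: U lU {LU IHL zU} => [|u U IHU] lU; first by exists (l + 1); split=> //; lra.
  have [w [lw wU]] := IHU (fun u' Uu' => lU u' (mem_behead (s := u :: U) Uu')).
  exists (Num.min w ((l + u) / 2)); have := lU u (mem_head _ _) => lu.
  split; first by rewrite lt_min lw; lra.
  move=> v; rewrite inE gt_min => /orP[/eqP->|/wU->//].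
  by apply/orP; right; lra.
exists w; split=> // l'; rewrite inE => /orP[/eqP->//|/Lz l'z].
by apply: lt_trans lw; apply: lt_le_trans zl.
Qed.

(* [b k] is the number of the points [1 - Y j], [1 + Y j] (j < k) that lie
   below [Y k], these points being sorted as
   [1 - Y k.-1, ..., 1 - Y 0, 1 + Y 0, ..., 1 + Y k.-1] when [Y 0 >= 0]. *)
Definition realises n b Y := forall j k, (j < k)%N -> (k < n)%N ->
  [/\ - Y k < Y j < Y k,
      if (k <= b k + j)%N then 1 < Y k + Y j else Y k + Y j < 1 &
      if (k + j < b k)%N then 1 < Y k - Y j else Y k - Y j < 1].

Lemma realises_eq n b Y Y' : {in gtn n, Y =1 Y'} ->
  realises n b Y -> realises n b Y'.
Proof.
move=> YY' HY j k jk kn; rewrite -!YY' ?inE//; first exact: HY.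
exact: ltn_trans kn.
Qed.

(** Negating [Y 0] exchanges [Y k + Y 0] and [Y k - Y 0], whose tests are [k <= b k] and [k < b k].
    These agree when [b k] differs from [k]. *)
Lemma realises_flip n b Y Y' : code_split n b -> realises n b Y ->
  Y' 0%N = - Y 0%N -> (forall k, (0 < k < n)%N -> Y' k = Y k) ->
  realises n b Y'.
Proof.
move=> sb HY Y0 YS [|j] k jk kn; have := HY _ _ jk kn.
  have bk : b k <> k by case: k jk kn => // k _; exact: sb.
  rewrite (YS k) ?jk// Y0 !addn0 (_ : (k <= b k)%N = (k < b k)%N); last by lia.
  by case: ifP => _ [/andP[? ?] ? ?]; split; try lra; apply/andP; split; lra.
by rewrite (YS k) ?(YS j.+1)//; lia.
Qed.

Lemma code_realisable n b : code_valid n b ->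
  exists Z, realises n b Z /\ forall k, (k < n)%N -> 0 < Z k.
Proof.
case: n => [|n] vb.
  by exists (fun=> 0); split.
(* The induction also keeps points with entry 0 below 1/2. After such an entry the next one may be
   any admissible value, so the last point has to lie below every 1 - Z_j. *)
suff [Z [HZ Z0 _]] : exists Z, [/\ realises n.+1 b Z,
    forall k, (k < n.+1)%N -> 0 < Z k &
    forall k, (k < n.+1)%N -> b k = 0%N -> Z k < 1 / 2].
  by exists Z.
elim: n vb => [|n IHn] vb.
  exists (fun=> 1 / 4); split=> [j [] //|k _|k _ _]; lra.
have [vb' [_ bn bnS]] := (code_validS _ _).1 vb.
have {IHn} [Z [HZ Z0 Zh]] := IHn vb'.
have Zmono j k : (j < k)%N -> (k < n.+1)%N -> Z j < Z k.
  by move=> jk kn; have [/andP[]] := HZ _ _ jk kn.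
have Zlast j : (j < n.+1)%N -> Z j <= Z n.
  by rewrite ltnS leq_eqVlt => /orP[/eqP->//|/Zmono/(_ (ltnSn _))/ltW].
(* [L] holds the last point and the points counted by [b n.+1]; [U] holds the points not counted,
   and 1/2 when the strengthened hypothesis asks for it. The new point goes in between. *)
pose L := Z n :: [seq 1 - Z j | j <- iota 0 n.+1 & (n.+1 <= b n.+1 + j)%N] ++
  [seq 1 + Z j | j <- iota 0 n.+1 & (n.+1 + j < b n.+1)%N].
pose U := [seq 1 - Z j | j <- iota 0 n.+1 & ~~ (n.+1 <= b n.+1 + j)%N] ++
  [seq 1 + Z j | j <- iota 0 n.+1 & ~~ (n.+1 + j < b n.+1)%N] ++
  (if b n.+1 == 0%N then [:: 1 / 2] else [::]).
have [l u|z [Lz zU]] := @exists_between L U.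
  rewrite inE !mem_cat => lL uU.
  have {lL} : [\/ l = Z n, exists2 j, (j < n.+1 <= b n.+1 + j)%N & l = 1 - Z j |
    exists2 j, ((j < n.+1) && (n.+1 + j < b n.+1))%N & l = 1 + Z j].
    case/or3P: lL => [/eqP->|/mapP[j]|/mapP[j]]; first by constructor 1.
      rewrite mem_filter mem_iota => ? ->; constructor 2; exists j => //; lia.
    rewrite mem_filter mem_iota => ? ->; constructor 3; exists j => //; lia.
  have {uU} : [\/ exists2 j, ((j < n.+1) && (b n.+1 + j < n.+1))%N & u = 1 - Z j ,
    exists2 j, ((j < n.+1) && (b n.+1 <= n.+1 + j))%N & u = 1 + Z j |
    b n.+1 = 0%N /\ u = 1 / 2].
    case/or3P: uU => [/mapP[j]|/mapP[j]|].
      rewrite mem_filter mem_iota => ? ->; constructor 1; exists j => //; lia.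
      rewrite mem_filter mem_iota => ? ->; constructor 2; exists j => //; lia.
    by case: eqP => // b0; rewrite mem_seq1 => /eqP ->; constructor 3.
  case=> [[j' /andP[j'n bj'] ->]|[j' /andP[j'n bj'] ->]|[b0 ->]];
    case=> [->|[j /andP[jn bj] ->]|[j /andP[jn bj] ->]].
  (* If [b n] is 0, both summands are below 1/2. Otherwise [b n < b n.+1], so [1 - Z j'] was already
     not counted for [Z n]. *)
  - have [bn0|bn0] := eqVneq (b n) 0%N.
      have := Zh n (ltnSn _) bn0; have := Zlast j' j'n; lra.
    have bb : (b n < b n.+1)%N by case/orP: bnS => // /eqP; move/eqP: bn0.
    have jn : (j' < n)%N by lia.
    have [_ + _] := HZ j' n jn (ltnSn _); rewrite ifN; last lia.
    lra.
  - have := Zmono j' j; suff jj : (j' < j)%N by move/(_ jj jn); lra.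
    lia.
  - lia.
  - have [bn0|bn0] := eqVneq (b n) 0%N.
      have := Zh n (ltnSn _) bn0; have := Z0 j' j'n; lra.
    have bb : (b n < b n.+1)%N by case/orP: bnS => // /eqP; move/eqP: bn0.
    move: j'n; rewrite ltnS leq_eqVlt => /orP[/eqP ->|j'n]; first lra.
    have [_ _] := HZ j' n j'n (ltnSn _); rewrite ifN; last lia.
    lra.
  - have := Z0 j jn; have := Z0 j' j'n; lra.
  - have := Zmono j j'; suff jj : (j < j')%N by move/(_ jj j'n); lra.
    lia.
  - by apply: Zh => //; lia.
  - lia.
  - lia.
exists (fun k => if k == n.+1 then z else Z k).
have Znz : Z n < z by apply: Lz; rewrite mem_head.
have neq k : (k < n.+1)%N -> (k == n.+1) = false by move=> kn; apply/eqP; lia.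
split.
- move=> j k jk; rewrite ltnS leq_eqVlt => /orP[/eqP kn|kn]; last first.
    by rewrite !neq//; [exact: HZ | exact: ltn_trans kn].
  rewrite kn in jk *; rewrite eqxx neq//.
  have jI : j \in iota 0 n.+1 by rewrite mem_iota; lia.
  split.
  + have := Z0 j jk; have := Zlast j jk; have := Z0 n (ltnSn _).
    by move=> ? ? ?; apply/andP; split; lra.
  + case: ifPn => bj.
      suff: 1 - Z j < z by lra.
      apply: Lz; rewrite inE mem_cat; apply/or3P/Or32/mapP.
      by exists j => //; rewrite mem_filter bj.
    suff: z < 1 - Z j by lra.
    apply: zU; rewrite mem_cat; apply/orP; left; apply/mapP.
    by exists j => //; rewrite mem_filter bj.
  + case: ifPn => bj.
      suff: 1 + Z j < z by lra.
      apply: Lz; rewrite inE mem_cat; apply/or3P/Or33/mapP.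
      by exists j => //; rewrite mem_filter bj.
    suff: z < 1 + Z j by lra.
    apply: zU; rewrite !mem_cat; apply/or3P/Or32/mapP.
    by exists j => //; rewrite mem_filter bj.
- move=> k; rewrite ltnS leq_eqVlt => /orP[/eqP ->|kn].
    by rewrite eqxx; apply: lt_trans Znz; exact: Z0.
  by rewrite neq//; exact: Z0.
- move=> k; rewrite ltnS leq_eqVlt => /orP[/eqP -> bn0|kn].
    by rewrite eqxx; apply: zU; rewrite !mem_cat bn0 mem_head !orbT.
  by rewrite neq//; exact: Zh.
Qed.

(** * Reading the code off a point *)

Lemma find_antitone N (P : pred nat) :
  (forall p q, (p <= q < N)%N -> P q -> P p) ->
  forall p, (p < N)%N -> P p = (p < find (predC P) (iota 0 N))%N.
Proof.
move=> aP p pN; apply/idP/idP => [Pp|pt].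
  rewrite ltnNge; apply/negP => tp.
  have tN : (find (predC P) (iota 0 N) < N)%N by apply: leq_ltn_trans pN.
  have ht : has (predC P) (iota 0 N) by rewrite has_find size_iota.
  have := nth_find 0%N ht; rewrite nth_iota ?add0n //=.
  by rewrite (aP _ p)// tp.
have := before_find 0%N pt; rewrite nth_iota//= add0n => /negbFE//.
Qed.

Lemma code_of_point n Z : 0 <= Z 0%N ->
  (forall j k, (j < k)%N -> (k < n)%N ->
     [/\ Z j < Z k, Z k + Z j != 1 & Z k - Z j != 1]) ->
  exists b, (forall k, (b k <= k.*2)%N) /\ realises n b Z.
Proof.
move=> Z0 HZ.
have Zge k : (k < n)%N -> 0 <= Z k.
  by case: k => // k kn; have [] := HZ 0%N k.+1 isT kn; lra.
have Zmono j k : (j <= k)%N -> (k < n)%N -> Z j <= Z k.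
  by rewrite leq_eqVlt => /orP[/eqP->//|jk kn]; have [/ltW] := HZ j k jk kn.
(* [v k] lists the 2k points in increasing order, so the first index at which [v k p < Z k] fails is
   the number of points below [Z k]. *)
pose v k p := if (p < k)%N then 1 - Z (k.-1 - p)%N else 1 + Z (p - k)%N.
have mv k p q : (k < n)%N -> (p <= q < k + k)%N -> v k q < Z k -> v k p < Z k.
  move=> kn /andP[pq qk]; apply: le_lt_trans; rewrite /v.
  case: ltnP => pk; case: ltnP => qk'.
  - by rewrite lerD2l lerN2 Zmono//; lia.
  - have := Zge (k.-1 - p)%N; have := Zge (q - k)%N.
    move=> /(_ ltac:(lia)) ? /(_ ltac:(lia)) ?; lra.
  - lia.
  - by rewrite lerD2l Zmono//; lia.
pose b k := find (predC (fun p => v k p < Z k)) (iota 0 (k + k)).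
have b2 k : (b k <= k + k)%N.
  by rewrite -[X in (_ <= X)%N](size_iota 0) find_size.
have bP k p : (k < n)%N -> (p < k + k)%N -> (v k p < Z k) = (p < b k)%N.
  move=> kn; apply: (@find_antitone _ (fun p => v k p < Z k)) => p' q.
  exact: mv.
exists b; split=> [k|j k jk kn]; first by rewrite -addnn.
have [jZ s1 d1] := HZ j k jk kn; split.
- rewrite jZ andbT; have := Zge j (ltn_trans jk kn); lra.
- have := bP k (k.-1 - j)%N kn ltac:(lia).
  rewrite /v ifT; last lia.
  rewrite (_ : k.-1 - (k.-1 - j) = j)%N; last lia.
  rewrite (_ : (k.-1 - j < b k)%N = (k <= b k + j)%N); last lia.
  move=> <-; case: ltP => ?; first lra.
  by rewrite lt_neqAle s1 /=; lra.
- have := bP k (k + j)%N kn ltac:(lia).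
  rewrite /v ifN; last lia.
  rewrite (_ : k + j - k = j)%N; last lia.
  move=> <-; case: ltP => ?; first lra.
  by rewrite lt_neqAle d1 /=; lra.
Qed.

(** The gap bounds give the conditions on [b 1] and on the size of entries. For the growth
    condition, the highest point below [Z k] is also below [Z k.+1], and its position has moved up
    by one because of the new lowest point [1 - Z k]. *)
Lemma realises_code_valid n b Z : (1 < n)%N -> (forall k, (b k <= k.*2)%N) ->
  realises n b Z -> Z 1%N + Z 0%N < 1 ->
  (forall k, (k.+1 < n)%N -> Z k.+1 - Z k < 1) -> code_valid n b.
Proof.
move=> n1 b2 HbZ Z10 ZS; split=> [|k kn].
  by have := b2 0%N; rewrite leqn0 => /eqP.
split.
- move=> k0; subst k; move: (HbZ 0%N 1%N isT n1) => [_ + _].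
  by case: ifPn => bk ?; [exfalso; lra | lia].
- have := ZS k kn; have [_ _] := HbZ k k.+1 (ltnSn _) kn.
  by case: ifPn => bk ? ?; [exfalso; lra | lia].
apply/orP; have [->|bk] := posnP (b k); [by left|right].
(* The highest point below [Z k] is [1 - Z (k - b k)] in the first case and [1 + Z (b k - k.+1)] in
   the second. *)
have [bkk|bkk] := leqP (b k) k.
  have [|jk] := leqP k (k - b k); first by case: (k) (b2 k) bk bkk => //; lia.
  have [_ + _] := HbZ _ _ jk (ltnW kn); rewrite ifT; last lia.
  have [/andP[_ Zk] + _] := HbZ (k - b k)%N k.+1 ltac:(lia) kn.
  have [/andP[_ Zkk] _ _] := HbZ k k.+1 ltac:(lia) kn.
  by case: ifPn => ? ? ?; [lia | exfalso; lra].
have jk : (b k - k.+1 < k)%N by have := b2 k; lia.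
have [_ _ +] := HbZ _ _ jk (ltnW kn); rewrite ifT; last lia.
have [/andP[_ Zk] _ +] := HbZ (b k - k.+1)%N k.+1 ltac:(lia) kn.
have [/andP[_ Zkk] _ _] := HbZ k k.+1 ltac:(lia) kn.
by case: ifPn => ? ? ?; [lia | exfalso; lra].
Qed.

(** The entry [b 1 = 0] keeps [Y 1 + Y 0] and [Y 1 - Y 0], hence [Y 1], below 1; from then on
    [b k.+1 < k.+1.*2] keeps every gap below 1. *)
Lemma realises_bound n b Y k : (1 < n)%N -> code_valid n b ->
  realises n b Y -> (k < n)%N -> `|Y k| <= n%:R.
Proof.
move=> n1 [b0 bS] HY.
have Y1 : `|Y 0%N| < Y 1%N < 1.
  have [b1 _ _] := bS 0%N n1; have [] := HY 0%N 1%N isT n1.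
  rewrite b1//= ltr_norml => /andP[? ?] ? ?.
  by apply/andP; split; [apply/andP; split; lra | lra].
have YS p : (p.+1 < n)%N -> 0 < Y p.+1 <= p.+1%:R.
  elim: p => [|p IHp] pn.
    by move: Y1; have := normr_ge0 (Y 0%N) => ? /andP[? ?]; apply/andP; split; lra.
  have [_ bp _] := bS p.+1 pn; have [/andP[? ?] _] := HY p.+1 p.+2 (ltnSn _) pn.
  rewrite ifN; last lia.
  have /andP[? ?] := IHp (ltnW pn); rewrite -natr1 => ?.
  by apply/andP; split; lra.
case: k => [|k] kn.
  have : 1 <= n%:R :> R by rewrite ler1n ltnW.
  by case/andP: Y1; lra.
have /andP[? ?] := YS k kn; rewrite gtr0_norm//.
have : k.+1%:R <= n%:R :> R by rewrite ler_nat ltnW.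
lra.
Qed.

(* Moving along the fundamental coweight of a simple root whose value exceeds
   1 leaves the cell unchanged, which is why such a cell is unbounded. *)
Lemma realises_shift n b Y K t : realises n b Y -> 0 <= Y 0%N -> 0 <= t ->
  (K < n)%N -> (if K is k.+1 then 1 < Y K - Y k else 1 < Y 1%N + Y 0%N) ->
  realises n b (fun k => Y k + if (K <= k)%N then t else 0).
Proof.
move=> HY Y0 t0 Kn HK.
have Zge k : (k < n)%N -> 0 <= Y k.
  by case: k => // k kn; have [/andP[]] := HY 0%N k.+1 isT kn; lra.
have Zmono j k : (j <= k)%N -> (k < n)%N -> Y j <= Y k.
  rewrite leq_eqVlt => /orP[/eqP->//|jk kn].
  by have [/andP[_ /ltW]] := HY j k jk kn.
move=> j k jk kn; have [/andP[? ?] S D] := HY j k jk kn.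
have jn := ltn_trans jk kn; have Yj := Zge j jn; have Yk := Zge k kn.
have [Kk|Kk] := leqP K k; last first.
  rewrite ifN; last lia.
  rewrite !addr0; split=> //; apply/andP; split; lra.
have [Kj|jK] := leqP K j.
  (* Both coordinates move: the difference is unchanged, and the growing sum is already above 1. *)
  have sum1 : 1 < Y k + Y j.
    case: K Kn HK Kk Kj => [|K] Kn HK Kk Kj.
      by have := Zmono 0%N j isT jn; have := Zmono 1%N k ltac:(lia) kn; lra.
    by have := Zge K ltac:(lia); have := Zmono K.+1 j Kj jn; lra.
  split; first by apply/andP; split; lra.
    by move: S; case: ifP => _ ?; lra.
  by move: D; case: ifP => _ ?; lra.
(* Only [Y k] moves: the sum and the difference grow, and both are already above 1. *)
have diff1 : 1 < Y k - Y j.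
  case: K Kn HK Kk jK => // K Kn HK Kk jK.
  by have := Zmono K.+1 k Kk kn; have := Zmono j K jK ltac:(lia); lra.
split; first by apply/andP; split; lra.
  by move: S; case: ifP => _ ?; lra.
by move: D; case: ifP => _ ?; lra.
Qed.

Lemma realises_eq_code n b b' Y : {in gtn n, b =1 b'} ->
  realises n b Y -> realises n b' Y.
Proof. by move=> bb' HY j k jk kn; rewrite -bb' ?inE//; exact: HY. Qed.

End Realisation.

(** * Cells in signed coordinates *)

Section SignedCoordinates.
Set Implicit Arguments.
Unset Strict Implicit.
Unset Printing Implicit Defensive.
Import Order.TTheory GRing.Theory Num.Theory.
Local Open Scope ring_scope.
Local Open Scope set_scope.
Variables (R : realFieldType) (n : nat).
Implicit Types (X : 'I_n -> R) (Y : nat -> R) (b : nat -> nat).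
Implicit Types (s : 'S_n) (eps : 'I_n -> bool) (i j k l : 'I_n) (e f : bool).

Definition scoord X i e : R := if e then - X i else X i.

(** Running over all signs and ordered pairs names each hyperplane more than once, but makes the
    condition visibly invariant under signed permutations. *)
Definition generic X := forall i j e f, i != j ->
  scoord X i e != scoord X j f /\ scoord X i e + 1 != scoord X j f.

Definition same_side X X' := forall i j e f, i != j ->
  (scoord X i e < scoord X j f) = (scoord X' i e < scoord X' j f) /\
  (scoord X i e + 1 < scoord X j f) = (scoord X' i e + 1 < scoord X' j f).

Definition adapted s eps Y X := forall k, Y k = scoord X (s k) (eps k).

Lemma scoord_adapted s eps Y X k e : adapted s eps Y X ->
  scoord X (s k) e = if e == eps k then Y k else - Y k.
Proof.
by move=> /(_ k) ->; rewrite /scoord; case: e; case: (eps k); rewrite /= ?opprK.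
Qed.

(** Negation swaps the two indices, so that the coordinate of smaller rank can always be put on the
    left. *)
Lemma scoord_ltN X i j e f :
  (scoord X j (~~ f) < scoord X i (~~ e)) = (scoord X i e < scoord X j f).
Proof. by case: e; case: f; rewrite /scoord /=; apply/idP/idP; lra. Qed.

Lemma scoord_lt1N X i j e f :
  (scoord X j (~~ f) + 1 < scoord X i (~~ e)) =
  (scoord X i e + 1 < scoord X j f).
Proof. by case: e; case: f; rewrite /scoord /=; apply/idP/idP; lra. Qed.

Lemma scoord_eqN X i j e f :
  (scoord X j (~~ f) == scoord X i (~~ e)) = (scoord X i e == scoord X j f).
Proof.
by case: e; case: f; rewrite /scoord /=; apply/eqP/eqP; lra.
Qed.

Lemma scoord_eq1N X i j e f :
  (scoord X j (~~ f) + 1 == scoord X i (~~ e)) =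
  (scoord X i e + 1 == scoord X j f).
Proof.
by case: e; case: f; rewrite /scoord /=; apply/eqP/eqP; lra.
Qed.

(** [Y k] dominates [Y l] in absolute value, so the sign given to the coordinate of larger rank
    decides. *)
Lemma realises_lt s eps b Y X k l e f : adapted s eps Y X -> realises n b Y ->
  (l < k)%N -> (scoord X (s l) e < scoord X (s k) f) = (f == eps k).
Proof.
move=> aX HY lk; rewrite !(scoord_adapted _ _ aX).
have [/andP[? ?] _ _] := HY _ _ lk (ltn_ord _).
by case: (f == eps k); case: (e == eps l); (apply/idP; lra) || (apply: le_gtF; lra).
Qed.

Lemma realises_lt1 s eps b Y X k l e f : adapted s eps Y X -> realises n b Y ->
  (l < k)%N -> (scoord X (s l) e + 1 < scoord X (s k) f) =
    (f == eps k) && (if e == eps l then k + l < b k else k <= b k + l)%N.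
Proof.
move=> aX HY lk; rewrite !(scoord_adapted _ _ aX).
have [/andP[? ?] S D] := HY _ _ lk (ltn_ord _).
case: (f == eps k); last by case: (e == eps l); apply: le_gtF; lra.
case: (e == eps l) => /=.
  by case: ifP D => _ ?; [apply/idP | apply: le_gtF]; lra.
by case: ifP S => _ ?; [apply/idP | apply: le_gtF]; lra.
Qed.

Lemma realises_neq s eps b Y X k l e f : adapted s eps Y X -> realises n b Y ->
  (l < k)%N -> scoord X (s l) e != scoord X (s k) f.
Proof.
move=> aX HY lk; rewrite !(scoord_adapted _ _ aX).
have [/andP[? ?] _ _] := HY _ _ lk (ltn_ord _).
by case: (f == eps k); case: (e == eps l); apply/eqP; lra.
Qed.

Lemma realises_neq1 s eps b Y X k l e f : adapted s eps Y X -> realises n b Y ->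
  (l < k)%N -> scoord X (s l) e + 1 != scoord X (s k) f.
Proof.
move=> aX HY lk; rewrite !(scoord_adapted _ _ aX).
have [/andP[? ?] S D] := HY _ _ lk (ltn_ord _).
case: (f == eps k); last by case: (e == eps l); apply/eqP; lra.
case: (e == eps l) => /=.
  by case: ifP D => _ ?; apply/eqP; lra.
by case: ifP S => _ ?; apply/eqP; lra.
Qed.

Lemma realises_generic s eps b Y X :
  adapted s eps Y X -> realises n b Y -> generic X.
Proof.
move=> aX HY i j e f; rewrite -(permKV s i) -(permKV s j) (inj_eq perm_inj).
rewrite neq_ltn => /orP[lk|lk].
  by rewrite (realises_neq _ _ aX HY lk) (realises_neq1 _ _ aX HY lk).
rewrite -scoord_eqN -scoord_eq1N.
by rewrite (realises_neq _ _ aX HY lk) (realises_neq1 _ _ aX HY lk).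
Qed.

Lemma realises_same_side s eps b Y Y' X X' :
  adapted s eps Y X -> adapted s eps Y' X' ->
  realises n b Y -> realises n b Y' -> same_side X X'.
Proof.
move=> aX aX' HY HY' i j e f.
rewrite -(permKV s i) -(permKV s j) (inj_eq perm_inj).
rewrite neq_ltn => /orP[lk|lk].
  rewrite (realises_lt _ _ aX HY lk) (realises_lt1 _ _ aX HY lk).
  by rewrite (realises_lt _ _ aX' HY' lk) (realises_lt1 _ _ aX' HY' lk).
rewrite -[in LHS]scoord_ltN -[in RHS]scoord_ltN.
rewrite -[in X in _ /\ X]scoord_lt1N -[in X in _ /\ _ = X]scoord_lt1N.
rewrite (realises_lt _ _ aX HY lk) (realises_lt1 _ _ aX HY lk).
by rewrite (realises_lt _ _ aX' HY' lk) (realises_lt1 _ _ aX' HY' lk).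
Qed.

(** The clauses of [realises] are comparisons of signed coordinates, which [same_side] transports;
    where a comparison fails, genericity of [X'] makes the opposite inequality strict. *)
Lemma same_side_realises s eps b Y Y' X X' :
  adapted s eps Y X -> adapted s eps Y' X' -> realises n b Y ->
  same_side X X' -> generic X' -> realises n b Y'.
Proof.
move=> aX aX' HY XX' gX' l k lk kn; have ln := ltn_trans lk kn.
pose K := Ordinal kn; pose L := Ordinal ln.
have sLK : s L != s K by rewrite (inj_eq perm_inj) neq_ltn /= lk.
have KE e : scoord X' (s L) e = if e == eps L then Y' l else - Y' l.
  by rewrite (scoord_adapted _ _ aX').
have LE : scoord X' (s K) (eps K) = Y' k by rewrite -(aX' K).
have lt e : scoord X' (s L) e < Y' k.
  rewrite -LE; have [<- _] := XX' (s L) (s K) e (eps K) sLK.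
  by rewrite (realises_lt _ _ aX HY) ?eqxx.
have lt1 e : (scoord X' (s L) e + 1 < Y' k) =
    (if e == eps L then k + l < b k else k <= b k + l)%N.
  rewrite -LE; have [_ <-] := XX' (s L) (s K) e (eps K) sLK.
  by rewrite (realises_lt1 _ _ aX HY) ?eqxx.
have ne1 e : scoord X' (s L) e + 1 != Y' k.
  by rewrite -LE; have [] := gX' _ _ e (eps K) sLK.
have := lt (eps L); have := lt1 (eps L); have := ne1 (eps L).
have := lt (~~ eps L); have := lt1 (~~ eps L); have := ne1 (~~ eps L).
rewrite !KE eqxx (_ : (~~ eps L == eps L) = false); last by case: (eps L).
move=> /eqP n1 <- l1 /eqP n2 <- l2; split; first by apply/andP; split; lra.
  by case: ltP => ?; lra.
by case: ltP => ?; lra.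
Qed.

(** This compares absolute values through signed coordinates alone, so that [same_side] preserves it
    for distinct indices. *)
Definition abs_lt X i j := [exists e, [forall f, scoord X i f < scoord X j e]].

Lemma abs_lt_adapted s eps b Y X k l : adapted s eps Y X -> realises n b Y ->
  abs_lt X (s k) (s l) = (k < l)%N.
Proof.
move=> aX HY; apply/existsP/idP => [[e /forallP He]|kl]; last first.
  by exists (eps l); apply/forallP => f; rewrite (realises_lt _ _ aX HY kl).
rewrite ltnNge leq_eqVlt; apply/negP => /orP[/eqP/val_inj lk|lk].
  by have := He e; rewrite lk ltxx.
have := He (eps k); rewrite -scoord_ltN (realises_lt _ _ aX HY lk).
by case: (eps k).
Qed.

(** Recovers the permutation from the cell: its inverse ranks the coordinates by absolute value. *)
Lemma rank_adapted s eps b Y X i : adapted s eps Y X -> realises n b Y ->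
  #|[set j | abs_lt X j i]| = s^-1%g i :> nat.
Proof.
move=> aX HY; rewrite -[i in LHS](permKV s).
have -> : [set j | abs_lt X j (s (s^-1%g i))] =
    [set s k | k in [set k : 'I_n | (k < s^-1%g i)%N]].
  apply/finset.setP => j; rewrite inE -[j](permKV s) (abs_lt_adapted _ _ aX HY).
  by rewrite mem_imset ?inE//; exact: perm_inj.
rewrite card_imset; last exact: perm_inj.
move: (s^-1%g i) => k.
rewrite -sum1dep_card -(big_ord_widen _ (fun=> 1%N) (ltnW (ltn_ord k))).
by rewrite sum1_card card_ord.
Qed.

Lemma same_side_perm s s' eps eps' b b' Y Y' X X' :
  adapted s eps Y X -> adapted s' eps' Y' X' ->
  realises n b Y -> realises n b' Y' -> same_side X X' -> s = s'.
Proof.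
move=> aX aX' HY HY' XX'; apply: invg_inj; apply/permP => i; apply: val_inj.
rewrite /= -(rank_adapted i aX HY) -(rank_adapted i aX' HY'); congr #|pred_of_set _|.
apply/finset.setP => j; rewrite !inE /abs_lt; have [->|ji] := eqVneq j i.
  by apply/existsP/existsP => -[e /forallP/(_ e)]; rewrite ltxx.
by apply: eq_existsb => e; apply: eq_forallb => f; have [] := XX' _ _ f e ji.
Qed.

Lemma same_side_sign s eps eps' b b' Y Y' X X' k l :
  adapted s eps Y X -> adapted s eps' Y' X' ->
  realises n b Y -> realises n b' Y' -> same_side X X' -> (l < k)%N ->
  eps k = eps' k.
Proof.
move=> aX aX' HY HY' XX' lk.
have slk : s l != s k by rewrite (inj_eq perm_inj) neq_ltn lk.
have [+ _] := XX' (s l) (s k) (eps l) (eps k) slk.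
rewrite (realises_lt _ _ aX HY lk) (realises_lt _ _ aX' HY' lk) eqxx.
by move/esym/eqP.
Qed.

Lemma same_side_code s eps eps' b b' Y Y' X X' k l e :
  adapted s eps Y X -> adapted s eps' Y' X' ->
  realises n b Y -> realises n b' Y' -> same_side X X' -> (l < k)%N ->
  (if e == eps l then k + l < b k else k <= b k + l)%N =
  (if e == eps' l then k + l < b' k else k <= b' k + l)%N.
Proof.
move=> aX aX' HY HY' XX' lk.
have slk : s l != s k by rewrite (inj_eq perm_inj) neq_ltn lk.
have [_] := XX' (s l) (s k) e (eps k) slk.
rewrite (realises_lt1 _ _ aX HY lk) (realises_lt1 _ _ aX' HY' lk) eqxx.
by rewrite (same_side_sign aX aX' HY HY' XX' lk) eqxx.
Qed.

Lemma same_side_code_inj s eps b b' Y Y' X X' k :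
  adapted s eps Y X -> adapted s eps Y' X' ->
  realises n b Y -> realises n b' Y' -> same_side X X' ->
  code_valid n b -> code_valid n b' -> b k = b' k.
Proof.
move=> aX aX' HY HY' XX' [b0 bS] [b0' bS'].
case: k => -[|k] kn; first by rewrite b0 b0'.
set K := Ordinal kn.
have H e (l : 'I_n) (lk : (l < K)%N) := same_side_code e aX aX' HY HY' XX' lk.
have [_ bk _] := bS k kn; have [_ bk' _] := bS' k kn.
(* [P] tests the point [1 - Y (k - p)] at position [p], and [Q] the point [1 + Y p] at position
   [k.+1 + p]; together they cover all positions. *)
have P p : (p <= k)%N -> (p < b k.+1)%N = (p < b' k.+1)%N.
  move=> pk; have ln : (k - p < n)%N by lia.
  have := H (~~ eps (Ordinal ln)) (Ordinal ln) ltac:(move=> /=; lia).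
  by case: (eps _) => /=; lia.
have Q p : (p <= k)%N -> (k.+1 + p < b k.+1)%N = (k.+1 + p < b' k.+1)%N.
  move=> pk; have ln : (p < n)%N by lia.
  have := H (eps (Ordinal ln)) (Ordinal ln) ltac:(move=> /=; lia).
  by rewrite eqxx.
apply/eqP; rewrite eqn_leq /=; apply/andP; split; rewrite leqNgt; apply/negP => lt.
  have [bk1|bk1] := leqP (b' k.+1) k; first by have := P _ bk1; lia.
  have := Q (b' k.+1 - k.+1)%N; lia.
have [bk1|bk1] := leqP (b k.+1) k; first by have := P _ bk1; lia.
have := Q (b k.+1 - k.+1)%N; lia.
Qed.

(** Opposite signs exchange the weak and the strict test at [p.+1]. Thus [b p.+1 = p.+1] would give
    [p.+1 < b' p.+1], and then [p.+1 < b p.+1]. *)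
Lemma same_side_code_split s eps eps' b b' Y Y' X X' k :
  adapted s eps Y X -> adapted s eps' Y' X' ->
  realises n b Y -> realises n b' Y' -> same_side X X' ->
  k = 0%N :> nat -> eps k != eps' k -> code_split n b /\ code_split n b'.
Proof.
move=> aX aX' HY HY' XX' k0 ek.
have H (p : nat) (pn : (p.+1 < n)%N) :
    (b p.+1 <= p.+1)%N = (b' p.+1 < p.+1)%N /\
    (b p.+1 < p.+1)%N = (b' p.+1 <= p.+1)%N.
  have kj : (k < Ordinal pn)%N by rewrite k0.
  have := same_side_code true aX aX' HY HY' XX' kj.
  have := same_side_code false aX aX' HY HY' XX' kj.
  by move: ek; rewrite k0; case: (eps k); case: (eps' k) => //= _; lia.
by split=> p pn; have := H p pn; lia.
Qed.

Lemma sort_adapted (Z : 'I_n -> R) : injective Z ->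
  exists s : 'S_n, forall k l, (k < l)%N -> Z (s k) < Z (s l).
Proof.
move=> Zinj; pose r i := #|[set j | Z j < Z i]|.
have rn i : (r i < n)%N.
  rewrite -[X in (_ < X)%N](card_ord n) -cardsT; apply: proper_card.
  by apply/properP; split; [exact: finset.subsetT | exists i; rewrite ?inE ?ltxx].
have rmono i j : Z i < Z j -> (r i < r j)%N.
  move=> ij; apply: proper_card; apply/properP; split.
    by apply/fintype.subsetP => k; rewrite !inE => /lt_trans; exact.
  by exists i; rewrite inE ?ltxx.
have rinj : injective (fun i => Ordinal (rn i)).
  move=> i j [rij]; apply: Zinj; apply/eqP; rewrite eq_le !leNgt.
  by apply/andP; split; apply/negP => /rmono; rewrite rij ltnn.
exists (perm rinj)^-1%g => k l kl; rewrite ltNge le_eqVlt.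
apply/negP => /orP[/eqP/Zinj/perm_inj kl'|/rmono]; first by rewrite kl' ltnn in kl.
have rE i : r ((perm rinj)^-1%g i) = i.
  by rewrite -[in RHS](permKV (perm rinj) i) permE.
by rewrite !rE ltnNge (ltnW kl).
Qed.

End SignedCoordinates.

(** * Regions as sign cells *)

Section Cells.
Set Implicit Arguments.
Unset Strict Implicit.
Unset Printing Implicit Defensive.
Import Order.TTheory GRing.Theory Num.Theory.
Local Open Scope ring_scope.
Variables (R : realType) (n : nat).
Implicit Types (A : arrangement R n) (x y : 'rV[R]_n).

Lemma dotD (a x y : 'rV[R]_n) : dot a (x + y) = dot a x + dot a y.
Proof.
by rewrite /dot -big_split; apply: eq_bigr => k _; rewrite !mxE mulrDr.
Qed.

Lemma dotZ (a x : 'rV[R]_n) t : dot a (t *: x) = t * dot a x.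
Proof.
by rewrite /dot big_distrr; apply: eq_bigr => k _; rewrite !mxE /= mulrCA.
Qed.

Lemma continuous_dot (a : 'rV[R]_n) : continuous (dot a).
Proof.
apply: continuous_big => [|k _ x]; first exact: add_continuous.
by apply: continuousM; [exact: cst_continuous | exact: coord_continuous].
Qed.

Lemma arr_complementP A x :
  arr_complement A x <-> forall h, h \in A -> dot h.1 x <> h.2.
Proof.
split=> [Ax h hA hx|Ax [h hA]]; first by apply: Ax; exists h.
exact: Ax.
Qed.

Lemma connected_component_arrP A x y : arr_complement A x ->
  connected_component (arr_complement A) x y <->
  arr_complement A y /\
  forall h, h \in A -> (dot h.1 x < h.2) = (dot h.1 y < h.2).
Proof.
move=> Ax; split=> [Cxy|[Ay xy]].
  split=> [|h hA]; first exact: connected_component_sub Cxy.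
  have Cx := connected_component_refl Ax.
  pose C := connected_component (arr_complement A) x.
  have : is_interval (dot h.1 @` C).
    apply/connected_intervalP; apply: connected_continuous_connected.
      exact: component_connected.
    by apply: continuous_subspaceT; exact: continuous_dot.
  move=> I; have nh : ~ (dot h.1 @` C) h.2.
    case=> z /connected_component_sub /arr_complementP/(_ h hA).
    by [].
  have Dx : (dot h.1 @` C) (dot h.1 x) by exists x.
  have Dy : (dot h.1 @` C) (dot h.1 y) by exists y.
  apply/idP/idP => lt; rewrite ltNge; apply/negP => ge; apply: nh.
    by apply: (I _ _ Dx Dy); rewrite (ltW lt).
  by apply: (I _ _ Dy Dx); rewrite (ltW lt).
pose f (t : R) := x + t *: (y - x).
have fc : continuous f.
  move=> t; apply: cvgD; first exact: cvg_cst.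
  by apply: cvgZr_tmp; exact: cvg_id.
have f0 : f 0 = x by rewrite /f scale0r addr0.
have f1 : f 1 = y by rewrite /f scale1r addrC subrK.
suff : (f @` `[0, 1]) `<=` connected_component (arr_complement A) x.
  by apply; exists 1 => //=; rewrite in_itv /= ler01 lexx.
apply: connected_component_max.
- by exists 0 => //=; rewrite in_itv /= ler01 lexx.
- move=> z [t /=]; rewrite in_itv /= => /andP[t0 t1] <-.
  apply/arr_complementP => h hA.
  have := (arr_complementP _ _).1 Ax h hA; have := (arr_complementP _ _).1 Ay h hA.
  have := xy h hA; rewrite /f dotD dotZ dotD -scaleN1r dotZ.
  move: (dot h.1 x) (dot h.1 y) h.2 => u v c uv vc uc.
  have [lt|ge] := ltP u c.
    move: uv; rewrite lt => /esym vlt; apply/eqP; rewrite lt_eqF//.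
    have [->|t0'] := eqVneq t 0; first lra.
    have : 0 < t by rewrite lt_def t0' t0.
    by nra.
  move: uv; rewrite ltNge ge => /esym/negbT; rewrite -leNgt => vge.
  have {}ge : c < u by rewrite lt_neqAle ge andbT eq_sym; apply/eqP.
  have {}vge : c < v by rewrite lt_neqAle vge andbT eq_sym; apply/eqP.
  apply/eqP; rewrite gt_eqF//.
  have [->|t0'] := eqVneq t 0; first lra.
  have : 0 < t by rewrite lt_def t0' t0.
  by nra.
- apply: connected_continuous_connected; first exact: segment_connected.
  exact: continuous_subspaceT.
Qed.

End Cells.

(** * The type D arrangement in centred coordinates *)

Section TypeD.
Set Implicit Arguments.
Unset Strict Implicit.
Unset Printing Implicit Defensive.
Import Order.TTheory GRing.Theory Num.Theory.
Local Open Scope ring_scope.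
Variables (R : realType) (n : nat).
Implicit Types (x y : 'rV[R]_n).
Local Notation A := (arrangement_D R n).

Lemma all_arrangement_D (P : 'rV[R]_n * R -> Prop) :
  (forall h, h \in A -> P h) <->
  forall i j : 'I_n, (i < j)%N ->
    (forall c, c \in [:: -2; -1; 0] -> P (basis_vec R i + basis_vec R j, c)) /\
    (forall c, c \in [:: -1; 0; 1] -> P (basis_vec R i - basis_vec R j, c)).
Proof.
split=> [H i j ij|H h].
  have ijA h : h \in [seq (basis_vec R i + basis_vec R j, c) | c <- [:: -2; -1; 0]]
      ++ [seq (basis_vec R i - basis_vec R j, c) | c <- [:: -1; 0; 1]] -> h \in A.
    move=> hij; apply/flattenP.
    exists ([seq (basis_vec R i + basis_vec R j, c) | c <- [:: -2; -1; 0]]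
      ++ [seq (basis_vec R i - basis_vec R j, c) | c <- [:: -1; 0; 1]]) => //.
    apply/allpairsPdep; exists i, j; split=> //; first by rewrite mem_enum.
    by rewrite mem_filter ij mem_enum.
  by split=> c cc; apply/H/ijA; rewrite mem_cat map_f ?orbT.
case/flattenP => S /allpairsPdep[i [j [_ + ->]]].
rewrite mem_filter mem_cat => /andP[ij _]; have [H1 H2] := H i j ij.
by case/orP => /mapP[c cc ->]; [exact: H1 | exact: H2].
Qed.

Lemma dot_basis x (i : 'I_n) : dot (basis_vec R i) x = x 0 i.
Proof.
rewrite /dot (bigD1 i)//= big1 ?addr0 => [|l li].
  by rewrite /basis_vec mxE !eqxx mul1r.
by rewrite /basis_vec mxE (negbTE li) andbF mul0r.
Qed.

Lemma dot_basisD x (i j : 'I_n) :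
  dot (basis_vec R i + basis_vec R j) x = x 0 i + x 0 j.
Proof.
rewrite -!dot_basis /dot -big_split; apply: eq_bigr => k _.
by rewrite !mxE mulrDl.
Qed.

Lemma dot_basisB x (i j : 'I_n) :
  dot (basis_vec R i - basis_vec R j) x = x 0 i - x 0 j.
Proof.
rewrite -!dot_basis /dot -sumrB; apply: eq_bigr => k _.
by rewrite !mxE mulrBl.
Qed.

(** A basis vector is half the sum of the normals e_k + e_l and e_k - e_l, up to sign. Boundedness
    of a region is therefore boundedness in the whole space. *)
Lemma mem_normal_span_D x : (1 < n)%N -> x \in normal_span A.
Proof.
move=> n1; rewrite (row_sum_delta x); apply: rpred_sum => i _; apply: rpredZ.
have nA (k l : 'I_n) : (k < l)%N ->
    basis_vec R k \in normal_span A /\ basis_vec R l \in normal_span A.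
  move=> kl.
  have [HD HB] := (all_arrangement_D (fun h => h \in A)).1 (fun _ => id) k l kl.
  have D : basis_vec R k + basis_vec R l \in normal_span A.
    apply/memv_span/mapP; exists (basis_vec R k + basis_vec R l, 0) => //.
    by apply: HD; rewrite !inE eqxx !orbT.
  have B : basis_vec R k - basis_vec R l \in normal_span A.
    apply/memv_span/mapP; exists (basis_vec R k - basis_vec R l, 0) => //.
    by apply: HB; rewrite !inE eqxx !orbT.
  have half (u v : 'rV[R]_n) : u = 2^-1 *: (u + v + (u - v)).
    rewrite addrACA subrr addr0 -mulr2n -(scaler_nat 2 u) scalerA.
    by rewrite mulVf ?scale1r ?pnatr_eq0.
  split; first by rewrite (half (basis_vec R k) (basis_vec R l)) rpredZ// rpredD.
  rewrite (half (basis_vec R l) (basis_vec R k)) rpredZ// rpredD// 1?addrC//.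
  by rewrite addrC -opprB rpredN.
have [i0|i0] := posnP i.
  by case: (nA i (Ordinal n1)); rewrite //= i0.
by case: (nA (Ordinal (ltnW n1)) i).
Qed.

Definition recenter x (i : 'I_n) : R := x 0 i + 2^-1.

Lemma arr_complement_D x : arr_complement A x <-> generic (recenter x).
Proof.
rewrite arr_complementP all_arrangement_D; split=> [H i j e f ij|H i j ij].
  wlog lt_ij : i j e f ij / (i < j)%N.
    move=> W; move: (ij); rewrite neq_ltn => /orP[/(W i j e f ij)//|ji].
    rewrite -scoord_eqN -scoord_eq1N; apply: W => //; by rewrite eq_sym.
  have {H} [H1 H2] := H i j lt_ij.
  have := H1 (-2); have := H1 (-1); have := H1 0.
  have := H2 (-1); have := H2 0; have := H2 1.
  rewrite /= dot_basisD dot_basisB !inE !eqxx !orbT.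
  do 6 move=> /(_ isT) ?.
  by rewrite /scoord /recenter; split; apply/eqP; case: e; case: f; lra.
have nij : i != j by rewrite neq_ltn ij.
have Hs e f := H i j e f nij.
move: (Hs false false) (Hs false true) (Hs true false) (Hs true true).
rewrite /scoord /recenter.
move=> [/eqP ? /eqP ?] [/eqP ? /eqP ?] [/eqP ? /eqP ?] [/eqP ? /eqP ?].
split=> c; rewrite !inE => /or3P[] /eqP ->; rewrite /= ?dot_basisD ?dot_basisB; lra.
Qed.

Lemma same_side_D x y : generic (recenter x) -> generic (recenter y) ->
  (forall h, h \in A -> (dot h.1 x < h.2) = (dot h.1 y < h.2)) <->
  same_side (recenter x) (recenter y).
Proof.
move=> gx gy.
(* Six half-spaces face eight signed comparisons: each central wall, where X_i + X_j or X_i - X_j is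
   0, is met by two of them. Genericity turns negated comparisons into strict ones. *)
have E z (gz : generic (recenter z)) (i j : 'I_n) : (i < j)%N ->
    let S := scoord (recenter z) in
    [/\ (z 0 i + z 0 j < -2) = (S i false + 1 < S j true),
    (z 0 i + z 0 j < -1) = (S i false < S j true) /\
    (z 0 i + z 0 j < -1) = ~~ (S i true < S j false) &
    (z 0 i + z 0 j < 0) = ~~ (S i true + 1 < S j false)]
    /\ [/\ (z 0 i - z 0 j < -1) = (S i false + 1 < S j false),
    (z 0 i - z 0 j < 0) = (S i false < S j false) /\
    (z 0 i - z 0 j < 0) = ~~ (S i true < S j true) &
    (z 0 i - z 0 j < 1) = ~~ (S i true + 1 < S j true)].
  move=> ij S; have nij : i != j by rewrite neq_ltn ij.
  have Hs e f := gz i j e f nij.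
  move: (Hs false false) (Hs false true) (Hs true false) (Hs true true).
  rewrite /S /scoord /recenter.
  move=> [/eqP ? /eqP ?] [/eqP ? /eqP ?] [/eqP ? /eqP ?] [/eqP ? /eqP ?].
  by split; split; try split; rewrite -?leNgt; apply/idP/idP => ?; lra.
rewrite all_arrangement_D; split=> [H i j e f ij|H i j ij].
  wlog lt_ij : i j e f ij / (i < j)%N.
    move=> W; move: (ij); rewrite neq_ltn => /orP[/(W i j e f ij)//|ji].
    rewrite -[in LHS]scoord_ltN -[in RHS]scoord_ltN.
    rewrite -[in X in _ /\ X]scoord_lt1N -[in X in _ /\ _ = X]scoord_lt1N.
    by apply: W => //; rewrite eq_sym.
  have {H} [H1 H2] := H i j lt_ij.
  have := H1 (-2); have := H1 (-1); have := H1 0.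
  have := H2 (-1); have := H2 0; have := H2 1.
  rewrite /= !dot_basisD !dot_basisB !inE !eqxx !orbT.
  move=> /(_ isT) q3 /(_ isT) q2 /(_ isT) q1 /(_ isT) p3 /(_ isT) p2 /(_ isT) p1.
  have [[x1 [x2 x2'] x3] [x4 [x5 x5'] x6]] := E x gx i j lt_ij.
  have [[y1 [y2 y2'] y3] [y4 [y5 y5'] y6]] := E y gy i j lt_ij.
  case: e; case: f.
  - by split; apply: negb_inj; rewrite -?x5' -?y5' -?x6 -?y6.
  - by split; apply: negb_inj; rewrite -?x2' -?y2' -?x3 -?y3.
  - by rewrite -x2 -y2 -x1 -y1.
  - by rewrite -x5 -y5 -x4 -y4.
have [[x1 [x2 _] x3] [x4 [x5 _] x6]] := E x gx i j ij.
have [[y1 [y2 _] y3] [y4 [y5 _] y6]] := E y gy i j ij.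
have nij : i != j by rewrite neq_ltn ij.
have Hs e f := H i j e f nij.
split=> c; rewrite !inE /= ?dot_basisD ?dot_basisB => /or3P[] /eqP ->.
- by rewrite x1 y1; have [] := Hs false true.
- by rewrite x2 y2; have [] := Hs false true.
- by rewrite x3 y3; congr (~~ _); have [] := Hs true false.
- by rewrite x4 y4; have [] := Hs false false.
- by rewrite x5 y5; have [] := Hs false false.
- by rewrite x6 y6; congr (~~ _); have [] := Hs true true.
Qed.

Lemma component_D x y : generic (recenter x) ->
  connected_component (arr_complement A) x y <->
  generic (recenter y) /\ same_side (recenter x) (recenter y).
Proof.
move=> gx; rewrite connected_component_arrP; last exact/arr_complement_D.
rewrite arr_complement_D; split=> -[gy] xy; split=> //.
  exact/same_side_D.
exact/same_side_D.
Qed.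

End TypeD.

(** * Bounded regions of the type D arrangement *)

Section BoundedRegions.
Set Implicit Arguments.
Unset Strict Implicit.
Unset Printing Implicit Defensive.
Import Order.TTheory GRing.Theory Num.Theory.
Local Open Scope ring_scope.
Variables (R : realType) (m : nat).
Local Notation n := m.+2.
Local Notation A := (arrangement_D R n).
Implicit Types (x y : 'rV[R]_n) (s : 'S_n) (eps : 'I_n -> bool).

Local Notation region x := (connected_component (arr_complement A) x).

Definition uncenter (X : 'I_n -> R) : 'rV[R]_n := \row_i (X i - 2^-1).

Lemma uncenterK X : recenter (uncenter X) = X.
Proof. by apply/funext => i; rewrite /recenter mxE subrK. Qed.

Definition place s eps (Y : nat -> R) : 'rV[R]_n :=
  uncenter (fun i => let k := s^-1%g i in if eps k then - Y k else Y k).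

Lemma adapted_place s eps Y : adapted s eps Y (recenter (place s eps Y)).
Proof.
by move=> k; rewrite uncenterK /scoord permK; case: (eps k); rewrite ?opprK.
Qed.

(** [inord] extends the sequence to all naturals; only ranks below [n] carry meaning. *)
Definition ranked s eps x : nat -> R :=
  fun k => scoord (recenter x) (s (inord k)) (eps (inord k)).

Lemma adapted_ranked s eps x : adapted s eps (ranked s eps x) (recenter x).
Proof. by move=> k; rewrite /ranked inord_val. Qed.

Lemma normr_scoord (X : 'I_n -> R) i e : `|scoord X i e| = `|X i|.
Proof. by case: e; rewrite /scoord ?normrN. Qed.

Lemma rV_norm_le (x : 'rV[R]_n) c : 0 <= c -> (forall i, `|x 0 i| <= c) ->
  `|x| <= c.
Proof.
move=> c0 xc; rewrite /Num.norm /= mx_normrE; apply: bigmax_le => // -[i j] _.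
by rewrite ord1; exact: xc.
Qed.

Lemma rV_coord_le_norm (x : 'rV[R]_n) i : `|x 0 i| <= `|x|.
Proof.
rewrite [leRHS]/Num.norm /= mx_normrE.
exact: (le_bigmax _ (fun ij => `|x ij.1 ij.2|) (0, i)).
Qed.

Lemma is_bounded_regionE C : is_bounded_region A C <->
  exists x, [/\ generic (recenter x), C = region x & bounded_set (region x)].
Proof.
have spanE (D : set 'rV[R]_n) : D `&` [set x | x \in normal_span A] = D.
  by apply/setIidPl => x _; exact: mem_normal_span_D.
split=> [[[x Ax ->]]|[x [gx -> bx]]].
  by rewrite spanE => bx; exists x; split=> //; exact/arr_complement_D.
split; last by rewrite spanE.
by exists x => //; exact/arr_complement_D.
Qed.

(** All points of the region share the code, so [realises_bound] applies to each; the added 1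
    absorbs the recentring by 1/2. *)
Lemma region_bounded s eps b Y x : adapted s eps Y (recenter x) ->
  realises n b Y -> code_valid n b -> bounded_set (region x).
Proof.
move=> aY HY vb; exists (n%:R + 1); split=> [|M nM y /= xy].
  exact: num_real.
have gx := realises_generic aY HY.
have [gy sxy] := (component_D y gx).1 xy.
have aY' := adapted_ranked s eps y.
have HY' := same_side_realises aY aY' HY sxy gy.
have yi i : `|y 0 i| <= n%:R + 1.
  have -> : y 0 i = recenter y i - 2^-1 by rewrite /recenter addrK.
  apply: le_trans (ler_normB _ _) _; rewrite -[i](permKV s).
  move: (s^-1%g i) => k; rewrite -(normr_scoord _ _ (eps k)) -(aY' k).
  apply: lerD; first exact: realises_bound HY' _.
  by rewrite ger0_norm ?invr_ge0// invf_le1// ler1n.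
apply: le_trans (ltW nM); apply: rV_norm_le => //.
Qed.

(** A gap above 1 would, by [realises_shift], give points of the region with an arbitrarily large
    coordinate. *)
Lemma bounded_region_gaps s eps b Y x : adapted s eps Y (recenter x) ->
  realises n b Y -> 0 <= Y 0%N -> bounded_set (region x) ->
  Y 1%N + Y 0%N < 1 /\ forall k, (k.+1 < n)%N -> Y k.+1 - Y k < 1.
Proof.
move=> aY HY Y0 [M [_ HM]].
have gx := realises_generic aY HY.
have far K : (K < n)%N ->
    ~ ((if K is k.+1 then 1 < Y K - Y k else 1 < Y 1%N + Y 0%N) : bool).
  (* The norm is tested against |M| + 1, and undoing the recentring costs less than 1. *)
  move=> Kn HK; pose t := `|M| + 2.
  have t0 : 0 <= t by rewrite addr_ge0.
  have YK : 0 <= Y K.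
    by case: (K) Kn {HK} => // k kn; have [/andP[]] := HY 0%N k.+1 isT kn; lra.
  have HY' := realises_shift HY Y0 t0 Kn HK.
  pose y := place s eps (fun k => Y k + if (K <= k)%N then t else 0).
  have aY' := adapted_place s eps (fun k => Y k + if (K <= k)%N then t else 0).
  have xy : region x y.
    apply/(component_D _ gx); split; first exact: realises_generic aY' HY'.
    exact: realises_same_side aY aY' HY HY'.
  have M1 : M < `|M| + 1 by have := ler_norm M; lra.
  have := HM _ M1 y xy; apply/negP; rewrite -ltNge.
  pose i := s (Ordinal Kn).
  apply: lt_le_trans (rV_coord_le_norm y i).
  have := aY' (Ordinal Kn); rewrite /= leqnn -/i => E.
  have : t <= `|recenter y i|.
    by rewrite -(normr_scoord _ _ (eps (Ordinal Kn))) -E ger0_norm; lra.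
  have := ler_normD (y 0 i) 2^-1.
  rewrite -/(recenter y i) [`|2^-1|]ger0_norm ?invr_ge0//.
  rewrite /t; have : 2^-1 < 1 :> R by rewrite invf_lt1// ltr1n.
  lra.
have ne k : (k.+1 < n)%N -> Y k.+1 - Y k != 1 /\ Y k.+1 + Y k != 1.
  move=> kn; have [_] := HY k k.+1 (ltnSn _) kn.
  by case: ifP => _; case: ifP => _ ? ?; split; apply/eqP; lra.
split=> [|k kn]; rewrite ltNge le_eqVlt; apply/negP => /orP[/eqP e|].
- by have [_ /eqP] := ne 0%N isT; rewrite e.
- exact: (far 0%N).
- by have [/eqP + _] := ne k kn; rewrite e.
- exact: (far k.+1).
Qed.

(** Genericity makes the absolute values distinct, so they can be sorted; the signs are those that
    make every ranked value nonnegative. *)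
Lemma sorted_point x : generic (recenter x) ->
  exists s eps b Y, [/\ adapted s eps Y (recenter x), 0 <= Y 0%N,
    forall k, (b k <= k.*2)%N & realises n b Y].
Proof.
move=> gx; pose X := recenter x.
have absE i : `|X i| = scoord X i (X i < 0).
  by rewrite /scoord; case: ltP => ?; [rewrite ltr0_norm | rewrite ger0_norm].
have [|s sP] := @sort_adapted R n (fun i => `|X i|).
  move=> i j; rewrite !absE => /eqP ij; apply/eqP; apply: contraTT ij => ij.
  by have [] := gx i j (X i < 0) (X j < 0) ij.
pose eps k := X (s k) < 0.
have aY := adapted_ranked s eps x.
have YE (k : 'I_n) : ranked s eps x k = `|X (s k)|.
  by rewrite /ranked inord_val absE.
have [|j k jk kn|b [b2 HY]] := @code_of_point R n (ranked s eps x).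
- by rewrite (YE ord0).
- have jn := ltn_trans jk kn.
  have YJ := YE (Ordinal jn); have YK := YE (Ordinal kn).
  have sjk : s (Ordinal jn) != s (Ordinal kn).
    by rewrite (inj_eq perm_inj) neq_ltn /= jk.
  have aJ := aY (Ordinal jn); have aK := aY (Ordinal kn).
  split; first by rewrite YJ YK; exact: sP.
    have [_ /eqP H] := gx _ _ (~~ eps (Ordinal jn)) (eps (Ordinal kn)) sjk.
    apply/eqP => E; apply: H; rewrite -[RHS]aK.
    rewrite (scoord_adapted _ _ aY) (_ : (_ == _) = false); last by case: (eps _).
    by rewrite /= -E addrC addrK.
  have [_ /eqP H] := gx _ _ (eps (Ordinal jn)) (eps (Ordinal kn)) sjk.
  apply/eqP => E; apply: H; rewrite -[RHS]aK -aJ /= -E.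
  by rewrite addrC subrK.
exists s, eps, b, (ranked s eps x); split=> //.
by rewrite (YE ord0).
Qed.

(** The sign at rank 0 is kept apart because it is stored, normalised, in the signed code. *)
Definition signs (ef : {ffun 'I_m.+1 -> bool}) (e0 : bool) (k : 'I_n) : bool :=
  if unlift ord0 k is Some k' then ef k' else e0.

Lemma bounded_region_code x : generic (recenter x) -> bounded_set (region x) ->
  exists s ef l e0 Y, [/\ (l, e0) \in signed_codes m,
    adapted s (signs ef e0) Y (recenter x) & realises n (nth 0%N l) Y].
Proof.
move=> gx bx; have [s [eps [b [Y [aY Y0 b2 HY]]]]] := sorted_point gx.
have [Y10 YS] := bounded_region_gaps aY HY Y0 bx.
have vb := realises_code_valid (n := n) isT b2 HY Y10 YS.
pose l := mkseq b n.
have bl : {in gtn n, b =1 nth 0%N l} by move=> k kn; rewrite nth_mkseq.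
have vl := code_valid_eq bl isT vb; have HYl := realises_eq_code bl HY.
have sl : size l = n by rewrite size_mkseq.
pose ef := [ffun k : 'I_m.+1 => eps (lift ord0 k)].
have sE e0 k : signs ef e0 (lift ord0 k) = eps (lift ord0 k).
  by rewrite /signs liftK ffunE.
have s0 e0 : signs ef e0 ord0 = e0 by rewrite /signs unlift_none.
have [sp|nsp] := boolP (splitb l); last first.
  exists s, ef, l, (eps ord0), Y; split=> //.
    apply/mem_signed_codes; split=> // _; rewrite -sl; exact/splitbP.
  by move=> k; have [j ->|->] := unliftP ord0 k; rewrite aY ?sE ?s0.
(* For a split code the sign at rank 0 becomes [false] by moving it into the value, so [Y' 0] may be
   negative. *)
pose Y' k := if (k == 0%N) && eps ord0 then - Y k else Y k.
exists s, ef, l, false, Y'; split.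
- by apply/mem_signed_codes.
- move=> k; rewrite /Y'; have [j ->|->] := unliftP ord0 k; rewrite aY ?sE ?s0//.
  by rewrite eqxx /scoord; case: (eps ord0); rewrite /= ?opprK.
rewrite /Y'; case: (boolP (eps ord0)) => e0; last first.
  by apply: realises_eq HYl => k _ /=; rewrite andbF.
apply: realises_flip HYl _ _ => //; first by rewrite -sl; exact/splitbP.
by case=> [|k].
Qed.

Lemma region_code_inj s s' ef ef' l l' e0 e0' Y Y' x x' :
  (l, e0) \in signed_codes m -> (l', e0') \in signed_codes m ->
  adapted s (signs ef e0) Y (recenter x) ->
  adapted s' (signs ef' e0') Y' (recenter x') ->
  realises n (nth 0%N l) Y -> realises n (nth 0%N l') Y' ->
  region x = region x' -> [/\ s = s', ef = ef' & (l, e0) = (l', e0')].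
Proof.
move=> /mem_signed_codes[sl vl nl] /mem_signed_codes[sl' vl' nl'].
move=> aY aY' HY HY' xx'.
have gx := realises_generic aY HY; have gx' := realises_generic aY' HY'.
have XX' : same_side (recenter x) (recenter x').
  apply: ((component_D x' gx).1 _).2; rewrite xx'.
  by apply: connected_component_refl; exact/arr_complement_D.
have ss' := same_side_perm aY aY' HY HY' XX'; subst s'.
have efE : ef = ef'.
  apply/ffunP => k.
  have := same_side_sign (k := lift ord0 k) (l := ord0) aY aY' HY HY' XX' isT.
  by rewrite /signs liftK.
(* Different signs would make both codes split, and for split codes both signs are normalised to
   [false]. *)
have e0E : e0 = e0'.
  apply/eqP; rewrite -[e0 == e0']negbK; apply/negP => ne0.
  have [] := @same_side_code_split _ _ _ _ _ _ _ _ _ _ _ ord0 aY aY' HY HY' XX' erefl.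
    by rewrite /signs unlift_none.
  by move: ne0; case: (e0) nl => [/(_ isT)//|]; case: (e0') nl' => [/(_ isT)//|].
split=> //; subst ef' e0'; congr pair; apply: (@eq_from_nth _ 0%N).
  by rewrite sl.
move=> i; rewrite sl => im.
exact: (same_side_code_inj (Ordinal im) aY aY' HY HY' XX' vl vl').
Qed.

End BoundedRegions.

(* The nat division is exact: (n - 2)! divides (2n - 3)! for n >= 2. *)
Theorem theorem5p3 (R : realType) (n : nat) (hn : (2 <= n)%N) :
  [set C : set 'rV[R]_n | is_bounded_region (arrangement_D R n) C]
    #= `I_(2 ^ (n - 1) * ((2 * n - 3)`! %/ (n - 2)`!) * (3 * n - 4))%N.
Proof.
case: n hn => [|[|m]] // _.
(* The labels of bounded regions: a permutation, the signs at positive ranks, and a position in the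
   list of signed codes. *)
pose T := ('S_m.+2 * {ffun 'I_m.+1 -> bool} * 'I_(size (signed_codes m)))%type.
pose code (o : T) := nth ([::], false) (signed_codes m) o.2.
have codeP o : code o \in signed_codes m by rewrite mem_nth.
(* For each label a realising point is chosen; [g] then enumerates the regions of these points. *)
have /choice[f fP] (o : T) : exists xY : 'rV[R]_m.+2 * (nat -> R),
    adapted o.1.1 (signs o.1.2 (code o).2) xY.2 (recenter xY.1) /\
    realises m.+2 (nth 0%N (code o).1) xY.2.
  have := codeP o; case: (code o) => l e /mem_signed_codes[_ vl _] /=.
  have [Z [HZ _]] := code_realisable R vl.
  by exists (place o.1.1 (signs o.1.2 e) Z, Z); split=> //; exact: adapted_place.
pose g (k : 'I_#|{: T}|) :=
  connected_component (arr_complement (arrangement_D R m.+2)) (f (enum_val k)).1.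
have -> : [set C | is_bounded_region (arrangement_D R m.+2) C] = range g.
  apply/seteqP; split=> [C /is_bounded_regionE[x [gx -> bx]]|_ [k _ <-]].
    have [s [ef [l [e [Y [le aY HY]]]]]] := bounded_region_code gx bx.
    have il : (index (l, e) (signed_codes m) < size (signed_codes m))%N.
      by rewrite index_mem.
    pose o : T := (s, ef, Ordinal il).
    have oE : code o = (l, e) by rewrite /code nth_index.
    exists (enum_rank o) => //; rewrite /g enum_rankK.
    have [af Hf] := fP o; rewrite oE in af Hf.
    apply: same_connected_component; apply/(component_D _ (realises_generic af Hf)).
    by split=> //; exact: realises_same_side af aY Hf HY.
  apply/is_bounded_regionE; exists (f (enum_val k)).1.
  have [af Hf] := fP (enum_val k); split=> //; first exact: realises_generic af Hf.
  have := codeP (enum_val k); move: af Hf; case: (code _) => l e af Hf.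
  by move=> /mem_signed_codes[_ vl _]; exact: region_bounded af Hf vl.
have g_inj : {in setT &, injective g}.
  move=> k k' _ _ /=; rewrite /g => gkk'; apply: enum_val_inj.
  move: (enum_val k) (enum_val k') gkk' => o o' oo'.
  have [af Hf] := fP o; have [af' Hf'] := fP o'.
  have cE u : ((code u).1, (code u).2) \in signed_codes m.
    by rewrite -surjective_pairing.
  have [s ef] := region_code_inj (cE o) (cE o') af af' Hf Hf' oo'.
  rewrite -!surjective_pairing => /eqP.
  rewrite nth_uniq ?uniq_signed_codes// => /eqP/val_inj.
  by move: s ef; case: (o) (o') => [[? ?] ?] [[? ?] ?] /= -> -> ->.
have -> : (2 ^ (m.+2 - 1) * ((2 * m.+2 - 3)`! %/ (m.+2 - 2)`!) *
    (3 * m.+2 - 4) = #|{: T}|)%N.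
  rewrite !card_prod card_Sn card_ffun !card_ord card_bool bounded_region_count.
  by congr (2 ^ _ * (_`! %/ _`!) * _)%N; lia.
apply: card_eq_trans (inj_card_eq g_inj) _.
by rewrite card_eq_sym; exact: card_II.
Qed.
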